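(* Let $\alpha\in(0,1)$, let $(P_\theta:\theta\in\Theta)$ be an arbitrary collection of distributions with densities $p_\theta$ with respect to a common measure $\mu$, and let $\Theta_0\subset\Theta$ be a (possibly composite) null set. Let $Y_1,\dots,Y_{2n}$ be i.i.d. from $P_{\theta^*}$, split into two groups $D_0,D_1$ of size $n$. Let $\widehat\theta_1\in\Theta$ be any estimator constructed from $D_1$, let $\widehat\theta_0\in\operatorname{argmax}_{\theta\in\Theta_0}\mathcal L_0(\theta)$ be the maximum likelihood estimator under the null hypothesis $H_0:\theta^*\in\Theta_0$ constructed from $D_0$, and set $$U_n=\frac{\mathcal L_0(\widehat\theta_1)}{\mathcal L_0(\widehat\theta_0)},\qquad W_n=\frac{U_n+U_n^{\mathrm{swap}}}{2}.$$ Then the split likelihood ratio test (reject $H_0$ if $U_n>1/\alpha$) and the crossfit likelihood ratio test (reject $H_0$ if $W_n>1/\alpha$) control the type I error at level $\alpha$: $$\sup_{\theta^*\in\Theta_0}P_{\theta^*}(U_n>1/\alpha)\le\alpha\qquad\text{and}\qquad \sup_{\theta^*\in\Theta_0}P_{\theta^*}(W_n>1/\alpha)\le\alpha .$$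
   Context: The split into $D_0,D_1$ is a partition of the data indices chosen independently of the data. $\mathcal L_0(\theta)=\prod_{i\in D_0}p_\theta(Y_i)$ is the likelihood based on $D_0$. $U_n^{\mathrm{swap}}$ is $U_n$ computed after swapping the roles of $D_0$ and $D_1$ (the estimator $\widehat\theta_1$ is replaced by one constructed from $D_0$, and the null maximum likelihood estimator and the likelihoods are computed on $D_1$). The null maximum likelihood estimators are assumed to exist, and all quantities are assumed measurable as needed. *)

(* Defs.v *)
From HB Require Import structures.
From mathcomp Require Import all_boot all_order all_algebra.
From mathcomp Require Import all_classical all_reals all_analysis.

Set Implicit Arguments.
Unset Strict Implicit.
Unset Printing Implicit Defensive.

Import Order.TTheory GRing.Theory Num.Theory.

Local Open Scope classical_set_scope.
Local Open Scope ring_scope.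

Definition is_density (d : measure_display) (X : measurableType d)
    (R : realType) (mu : {measure set X -> \bar R}) (P : probability X R)
    (f : X -> R) : Prop :=
  [/\ measurable_fun [set: X] f,
      forall x, 0 <= f x &
      forall A, measurable A -> P A = (\int[mu]_(x in A) (f x)%:E)%E].

Definition mutually_independent (d d' : measure_display)
    (Omega : measurableType d) (X : measurableType d') (R : realType)
    (P : probability Omega R) (I : finType) (Y : I -> {mfun Omega >-> X}) :
    Prop :=
  forall (J : {set I}) (A : I -> set X),
    (forall i, i \in J -> measurable (A i)) ->
    P (\bigcap_(i in [set` J]) (Y i @^-1` A i)) =
    (\prod_(i in J) P (Y i @^-1` A i))%E.

Definition iid (d d' : measure_display)
    (Omega : measurableType d) (X : measurableType d') (R : realType)
    (P : probability Omega R) (Q : probability X R)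
    (I : finType) (Y : I -> {mfun Omega >-> X}) : Prop :=
  mutually_independent P Y /\
  forall i A, measurable A -> distribution P (Y i) A = Q A.

Definition sample (d d' : measure_display)
    (Omega : measurableType d) (X : measurableType d') (N : nat)
    (Y : 'I_N -> {mfun Omega >-> X}) (w : Omega) : N.-tuple X :=
  [tuple Y i w | i < N].

(* [D0] is the (possibly random) first half of a split of the [2 * n] indices;
   the second half is its complement. A deterministic split is the case of a
   constant [D0]. The whole sample enters through the product sigma-algebra
   on tuples. *)
Definition data_independent_split (d d' : measure_display)
    (Omega : measurableType d) (X : measurableType d') (R : realType)
    (P : probability Omega R) (N : nat) (Y : 'I_N -> {mfun Omega >-> X})
    (D0 : Omega -> {set 'I_N}) : Prop :=
  forall (D : {set 'I_N}) (B : set (N.-tuple X)), measurable B ->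
    P ([set w | D0 w = D] `&` (sample Y @^-1` B)) =
    (P [set w | D0 w = D] * P (sample Y @^-1` B))%E.

Definition constructed_from (X Theta : Type) (N : nat) (D : {set 'I_N})
    (est : N.-tuple X -> Theta) : Prop :=
  forall y y' : N.-tuple X,
    (forall i, i \in D -> tnth y i = tnth y' i) -> est y = est y'.

Definition likelihood (X Theta : Type) (R : realType) (p : Theta -> X -> R)
    (N : nat) (D : {set 'I_N}) (theta : Theta) (y : N.-tuple X) : R :=
  \prod_(i in D) p theta (tnth y i).

Definition is_argmax (Theta : Type) (R : realType) (Theta0 : set Theta)
    (L : Theta -> R) (t : Theta) : Prop :=
  Theta0 t /\ forall theta, Theta0 theta -> L theta <= L t.

(* [D] carries the likelihoods and the null maximum likelihood estimator
   [mle D]; [est (~: D)] is the estimator built from the other half.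
   When the denominator vanishes the quotient is 0 by the convention on
   inverses; since [mle D] is an argmax over the null set, this can only happen
   on an event of probability zero under each null distribution. *)
Definition split_LR (X Theta : Type) (R : realType) (p : Theta -> X -> R)
    (N : nat) (est mle : {set 'I_N} -> N.-tuple X -> Theta)
    (D : {set 'I_N}) (y : N.-tuple X) : R :=
  likelihood p D (est (~: D) y) y / likelihood p D (mle D y) y.

Definition crossfit_LR (X Theta : Type) (R : realType) (p : Theta -> X -> R)
    (N : nat) (est est_swap mle : {set 'I_N} -> N.-tuple X -> Theta)
    (D : {set 'I_N}) (y : N.-tuple X) : R :=
  (split_LR p est mle D y + split_LR p est_swap mle (~: D) y) / 2.

(* Main.v *)
Require Import Defs.
From HB Require Import structures.
From mathcomp Require Import all_boot all_order all_algebra.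
From mathcomp Require Import all_classical all_reals all_analysis.
From mathcomp Require Import measurable_realfun.

Import Order.TTheory GRing.Theory Num.Theory.

Local Open Scope classical_set_scope.
Local Open Scope ring_scope.

(* Under a null theta, the maximum likelihood property gives, almost surely,
   U <= L_0(theta_1) / L_0(theta). Given the data in D1 the estimator theta_1
   is a fixed parameter t, and each factor p_t / p_theta integrates to at most
   1 under P_theta. Only the joint likelihood L_0(theta_1) is assumed
   measurable, so instead of factoring a conditional expectation, the
   coordinates in D0 are integrated out one at a time, the pointwise bound by
   the product of the remaining factors being preserved. Hence E U <= 1,
   likewise E W <= 1, and Markov's inequality concludes. *)

(** * Product laws on tuples and resampling of a coordinate *)

Section tuple_boxes.
Context {d : measure_display} {X : measurableType d} {R : realType} {N : nat}.

Definition box (A : 'I_N -> set X) : set (N.-tuple X) :=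
  [set y | forall i, A i (tnth y i)].

Lemma measurable_box (A : 'I_N -> set X) :
  (forall i, measurable (A i)) -> measurable (box A).
Proof.
move=> mA.
have -> : box A = \bigcap_(i in [set: 'I_N]) ((@tnth N X)^~ i @^-1` A i).
  by apply/seteqP; split=> y /= yA i; [move=> _|]; exact: yA.
apply: fin_bigcap_measurable; first exact: finite_finset.
by move=> i _; rewrite -[X in measurable X]setTI; exact: measurable_tnth.
Qed.

(** Boxes with measurable sides are stable under intersection and generate the sigma-algebra on
    tuples, so this is an instance of the pi-lambda uniqueness theorem. *)
Lemma measure_tuple_unique (m1 m2 : {measure set (N.-tuple X) -> \bar R}) :
  (m1 setT < +oo)%E ->
  (forall A, (forall i, measurable (A i)) -> m1 (box A) = m2 (box A)) ->
  forall B, measurable B -> m1 B = m2 B.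
Proof.
move=> m1oo m12 B mB.
pose G := [set B | exists2 A, forall i : 'I_N, measurable (A i : set X) & B = box A].
have boxT : box (fun=> setT) = setT by apply/seteqP; split.
apply: (measure_unique G (fun=> setT)) => //.
- apply/seteqP; split.
    apply: smallest_sub; first exact: smallest_sigma_algebra.
    rewrite -bigcup_seq => _ [i _ [A mA <-]]; apply: sub_sigma_algebra.
    (* A generator of the sigma-algebra constrains one coordinate only: it is a box whose other
       sides are full. *)
    exists (fun j => if j == i then A else setT).
      by move=> j; case: ifP.
    rewrite setTI; apply/seteqP; split=> y /=.
      by move=> Ay j; case: eqP => // ->.
    by move=> /(_ i); rewrite eqxx.
  apply: smallest_sub; first exact: sigma_algebra_measurable.
  by move=> _ [A mA ->]; exact: measurable_box.
- move=> _ _ [A mA ->] [A' mA' ->]; exists (fun i => A i `&` A' i).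
    by move=> i; exact: measurableI.
  apply/seteqP; split=> y /=; first by move=> [yA yA'] i; split.
  by move=> yAA'; split=> i; case: (yAA' i).
- by move=> _; exists (fun=> setT) => //; rewrite boxT.
- by rewrite bigcup_const.
- by move=> _ [A mA ->]; exact: m12.
Qed.

(** The resampling map. It takes a pair so that [m \x Q] can be pushed forward along it, and it
    overwrites a coordinate instead of deleting it, which keeps the length of the tuple fixed. *)
Definition tset (i : 'I_N) (z : N.-tuple X * X) : N.-tuple X :=
  [tuple if j == i then z.2 else tnth z.1 j | j < N].

Lemma tnth_tset i z j : tnth (tset i z) j = if j == i then z.2 else tnth z.1 j.
Proof. by rewrite tnth_mktuple. Qed.

Lemma measurable_tset i : measurable_fun [set: N.-tuple X * X] (tset i).
Proof.
apply/measurable_fun_tnthP => j.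
rewrite (_ : _ \o _ =
    fun z : N.-tuple X * X => if j == i then z.2 else tnth z.1 j); last first.
  by apply/funext => z /=; rewrite tnth_tset.
case: (j == i); first exact: measurable_snd.
exact: (measurableT_comp (measurable_tnth j) measurable_fst).
Qed.

HB.instance Definition _ i :=
  isMeasurableFun.Build _ _ _ _ (tset i) (measurable_tset i).

(** Replacing one coordinate of an i.i.d. tuple by an independent fresh draw leaves the law
    unchanged, as comparing both laws on boxes shows; Tonelli then separates the fresh draw. *)
Lemma integral_resample (Q : probability X R)
    (m : probability (N.-tuple X) R) (i : 'I_N) (f : N.-tuple X -> \bar R) :
  (forall A, (forall i, measurable (A i)) -> m (box A) = (\prod_i Q (A i))%E) ->
  measurable_fun [set: N.-tuple X] f -> (forall y, 0 <= f y)%E ->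
  (\int[m]_y f y = \int[m]_y \int[Q]_x f (tset i (y, x)))%E.
Proof.
move=> m_box mf f0.
have mm' B : measurable B -> m B = pushforward (m \x Q)%E (tset i) B.
  apply: measure_tuple_unique => //.
    by apply: (le_lt_trans (probability_le1 m measurableT)); rewrite ltry.
  move=> A mA; rewrite [RHS]/= /pushforward.
  (* The old value of coordinate [i] becomes unconstrained, and the fresh value takes over the side
     [A i]. *)
  have -> : tset i @^-1` box A =
            box (fun j => if j == i then setT else A j) `*` A i.
    apply/seteqP; split=> -[y x] /=.
      move=> yA; split.
        by move=> j; have := yA j; rewrite tnth_tset; case: eqP.
      by have := yA i; rewrite tnth_tset eqxx.
    move=> [yA xA] j; rewrite tnth_tset; case: eqP => [->//|ji].
    by have := yA j; case: eqP ji.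
  have mA' j : measurable (if j == i then setT else A j) by case: ifP.
  transitivity (m (box (fun j => if j == i then setT else A j)) * Q (A i))%E.
    rewrite m_box//; apply: (eq_trans (m_box A mA)).
    rewrite (bigD1 i)//= [in RHS](bigD1 i)//= eqxx probability_setT mul1e muleC.
    by congr (_ * _)%E; apply: eq_bigr => j /negbTE ->.
  by rewrite product_measure1E//; exact: measurable_box.
transitivity (\int[pushforward (m \x Q)%E (tset i)]_y f y)%E.
  by apply: eq_measure_integral => B mB _; exact: mm'.
rewrite ge0_integral_pushforward//= preimage_setT fubini_tonelli1//.
exact: measurableT_comp.
Qed.

End tuple_boxes.

(** Induction on [s], with [f] general: averaging [f] over a fresh coordinate [i] keeps it
    measurable, and as [t] does not see that coordinate, the factor at [i] contributes at most 1.
    Only [f] has to be measurable; [t] enters through the pointwise bound alone. *)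
Lemma integral_le1_of_le_prod {d : measure_display} {X : measurableType d}
    {R : realType} {N : nat} {Theta : Type} (Q : probability X R)
    (m : probability (N.-tuple X) R) (r : Theta -> X -> R) :
  (forall A, (forall i, measurable (A i)) -> m (box A) = (\prod_i Q (A i))%E) ->
  (forall t, measurable_fun [set: X] (r t)) ->
  (forall t x, 0 <= r t x) ->
  (forall t, \int[Q]_x (r t x)%:E <= 1)%E ->
  forall (s : seq 'I_N) (t : N.-tuple X -> Theta) (f : N.-tuple X -> \bar R),
  uniq s ->
  (forall i z, i \in s -> t (tset i z) = t z.1) ->
  measurable_fun [set: N.-tuple X] f ->
  (forall y, 0 <= f y)%E ->
  (forall y, f y <= (\prod_(i <- s) r (t y) (tnth y i))%:E)%E ->
  (\int[m]_y f y <= 1)%E.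
Proof.
move=> m_box mr r0 intr; elim=> [|i s IHs] t f /=.
  move=> _ _ mf f0 fle; apply: (@le_trans _ _ (\int[m]_y cst 1%E y)%E).
    apply: ge0_le_integral => //.
    by move=> y _; have := fle y; rewrite big_nil.
  by rewrite integral_cst//= mul1e probability_le1.
move=> /andP[is' us] tinv mf f0 fle.
rewrite (integral_resample _ _ i _ m_box mf f0).
have mfi : measurable_fun [set: N.-tuple X * X] (f \o tset i).
  exact: measurableT_comp.
apply: (IHs t) => //.
- by move=> j z js; apply: tinv; rewrite inE js orbT.
- by apply: (measurable_fun_fubini_tonelli_F (m2 := Q) (f \o tset i)) => // z; exact: f0.
- by move=> y; exact: integral_ge0.
move=> y; set c := \prod_(j <- s) _.
have c0 : 0 <= c by exact: prodr_ge0.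
apply: (@le_trans _ _ (\int[Q]_x (c%:E * (r (t y) x)%:E))%E).
  apply: ge0_le_integral => //.
  - exact: measurable_fun_pair2 mfi.
  - by apply: measurable_funeM; exact/measurable_EFinP.
  move=> x _; apply: (le_trans (fle _)).
  (* The fresh value affects the head factor only: [t] ignores coordinate [i], and [i] does not
     occur in [s], so the other factors still multiply to [c]. *)
  rewrite big_cons tinv ?mem_head// tnth_tset eqxx /= -EFinM lee_fin mulrC.
  rewrite le_eqVlt; apply/orP; left; apply/eqP; congr (_ * _).
  apply: eq_big_seq => j js; rewrite tnth_tset.
  by case: eqP => // ji; rewrite -ji js in is'.
rewrite ge0_integralZl//; last 2 first.
  - exact/measurable_EFinP.
  - by move=> x _; rewrite lee_fin.
by rewrite -[leRHS]mule1; apply: lee_wpmul2l; rewrite ?lee_fin.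
Qed.

(** Writing the inverse as [f] times the power -1 of its square gives [powR] a nonnegative base; at
    a zero of [f] both sides are 0. *)
Lemma measurable_funV {d : measure_display} {T : measurableType d}
    {R : realType} (D : set T) (f : T -> R) :
  measurable_fun D f -> measurable_fun D (fun x => (f x)^-1).
Proof.
move=> mf; rewrite (_ : (fun _ => _) = f \* (fun x => (f x ^+ 2) `^ (-1))).
  apply: measurable_funM => //.
  apply: (measurableT_comp (measurable_powR (-1))).
  exact: measurable_funX.
apply/funext => x /=; rewrite powR_inv1 ?sqr_ge0//.
have [->|f0] := eqVneq (f x) 0; first by rewrite invr0 mul0r.
by rewrite expr2 invfM mulrA mulfV// mul1r.
Qed.

(** * Integration against a density *)

Section density.
Context {d : measure_display} {X : measurableType d} {R : realType}.
Variables (mu : {measure set X -> \bar R}).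

Import HBNNSimple.

(** On indicators this is the defining property of a density; linearity extends it to simple
    functions and monotone convergence to [h]. *)
Lemma integral_density (P : probability X R) (f h : X -> R) :
  is_density mu P f -> measurable_fun [set: X] h ->
  (forall x, 0 <= h x) ->
  (\int[P]_x (h x)%:E = \int[mu]_x (h x * f x)%:E)%E.
Proof.
move=> [mf f0 Pf] mh h0.
have mhE : measurable_fun [set: X] (EFin \o h) by exact/measurable_EFinP.
pose g := nnsfun_approx measurableT mhE.
have gh x : (EFin \o g ^~ x) n @[n --> \oo] --> (h x)%:E.
  by apply: cvg_nnsfun_approx => // y _; rewrite lee_fin.
have mg n : measurable_fun [set: X] (EFin \o g n).
  exact/measurable_EFinP/measurable_funP.
have step n : (\int[P]_x (g n x)%:E = \int[mu]_x (g n x * f x)%:E)%E.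
  transitivity (\int[P]_x
      (\sum_(y \in range (g n)) (y * \1_(g n @^-1` [set y]) x)%:E))%E.
    by apply: eq_integral => t tE; rewrite fimfunE -fsumEFin.
  rewrite ge0_integral_fsum//; last 2 first.
  - by move=> y; apply/measurable_EFinP/measurable_funM.
  - by move=> y x _; exact: nnfun_muleindic_ge0.
  transitivity (\int[mu]_x (\sum_(y \in range (g n))
      ((y * \1_(g n @^-1` [set y]) x)%:E * (f x)%:E)))%E; last first.
    apply: eq_integral => t tE.
    rewrite -ge0_mule_fsuml; last by move=> y; exact: nnfun_muleindic_ge0.
    by rewrite fsumEFin// -(fimfunE _ t) -EFinM.
  rewrite ge0_integral_fsum//; last 2 first.
  - move=> y; apply: emeasurable_funM; last exact/measurable_EFinP.
    by apply/measurable_EFinP/measurable_funM.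
  - by move=> y x _; apply: mule_ge0; rewrite ?lee_fin//; exact: nnfun_muleindic_ge0.
  apply: eq_fsbigr => y /set_mem[x _ yE].
  under eq_integral do rewrite EFinM.
  under [RHS]eq_integral do rewrite EFinM -muleA.
  have y0 : 0 <= y by rewrite -yE.
  rewrite ge0_integralZl//; last exact/measurable_EFinP.
  rewrite ge0_integralZl//; last 2 first.
  - by apply: emeasurable_funM; exact/measurable_EFinP.
  - by move=> z _; rewrite mule_ge0 ?lee_fin.
  congr (_ * _)%E; transitivity (P (g n @^-1` [set y])).
    by rewrite integral_indic// setIT.
  rewrite Pf// integral_mkcond; apply: eq_integral => z _.
  by rewrite epatch_indic muleC.
transitivity (limn (fun n => \int[P]_x (g n x)%:E))%E.
  rewrite -monotone_convergence//.
  - by apply: eq_integral => x _; apply/esym/cvg_lim => //; exact: gh.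
  - by move=> n x _; rewrite lee_fin.
  - by move=> x _ a b ab; rewrite lee_fin; exact/lefP/nd_nnsfun_approx.
under eq_fun do rewrite step.
rewrite -monotone_convergence//.
- apply: eq_integral => x _; apply/cvg_lim => //.
  under eq_fun do rewrite EFinM.
  rewrite EFinM; apply: cvgeZr; [by []|exact: gh].
- by move=> n; apply/measurable_EFinP/measurable_funM.
- by move=> n x _; rewrite lee_fin mulr_ge0.
- move=> x _ a b ab; rewrite lee_fin ler_wpM2r//.
  exact/lefP/nd_nnsfun_approx.
Qed.

(** Against the density, [f] cancels where it is nonzero and the integrand is 0 elsewhere, so at
    most the total mass of [f'] remains. The inequality is strict when [P'] charges the zeros of
    [f]. *)
Lemma integral_density_ratio (P P' : probability X R) (f f' : X -> R) :
  is_density mu P f -> is_density mu P' f' ->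
  (\int[P]_x (f' x / f x)%:E <= 1)%E.
Proof.
move=> Pf Pf'; have [mf f0 _] := Pf; have [mf' f'0 P'f'] := Pf'.
rewrite (integral_density P f)//; last 2 first.
  - by apply: measurable_funM => //; exact: measurable_funV.
  - by move=> x; rewrite divr_ge0.
rewrite -(probability_setT P') P'f'//; apply: ge0_le_integral => //.
- by move=> x _; rewrite lee_fin mulr_ge0// divr_ge0.
- apply/measurable_EFinP; do 2 apply: measurable_funM => //.
  exact: measurable_funV.
- exact/measurable_EFinP.
move=> x _; rewrite lee_fin.
have [->|fx0] := eqVneq (f x) 0; first by rewrite mulr0.
by rewrite divfK.
Qed.

Lemma density_eq0_negligible (P : probability X R) (f : X -> R) :
  is_density mu P f -> P [set x | f x = 0] = 0%E.
Proof.
move=> [mf f0 Pf].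
have m0 : measurable [set x | f x = 0].
  by rewrite -[X in measurable X]setTI; exact: mf (measurable_set1 0).
by rewrite Pf// integral0_eq// => x /= ->.
Qed.

End density.

(** * Law of the sample and reduction to deterministic splits *)

Section sample_law.
Context {d d' : measure_display} {Omega : measurableType d}
  {X : measurableType d'} {R : realType} {N : nat}.
Variable Y : 'I_N -> {mfun Omega >-> X}.

Lemma measurable_sample : measurable_fun [set: Omega] (sample Y).
Proof.
apply/measurable_fun_tnthP => i.
rewrite (_ : _ \o _ = Y i)//.
by apply/funext => w /=; rewrite tnth_mktuple.
Qed.

HB.instance Definition _ :=
  isMeasurableFun.Build _ _ _ _ (sample Y) measurable_sample.

Lemma distribution_sample_box (P : probability Omega R) (Q : probability X R) :
  iid P Q Y -> forall A, (forall i, measurable (A i)) ->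
  distribution P (sample Y) (box A) = (\prod_i Q (A i))%E.
Proof.
move=> [indep ident] A mA.
transitivity (P (\bigcap_(i in [set` [set: 'I_N]%SET]) (Y i @^-1` A i))).
  congr (P _); apply/seteqP; split=> w /= wA i; first move=> _; have := wA i.
    by rewrite tnth_mktuple.
  by rewrite tnth_mktuple; apply; rewrite /= finset.in_setT.
rewrite indep//; apply: eq_big => [i|i _]; first by rewrite finset.in_setT.
exact: ident.
Qed.

(* A split independent of the data mixes the tests attached to the
   deterministic splits, each of which has level [alpha]. *)
Lemma split_test_level (P : probability Omega R) (D0 : Omega -> {set 'I_N})
    (alpha : R) (T : {set 'I_N} -> N.-tuple X -> R) :
  0 < alpha ->
  (forall D, measurable [set w | D0 w = D]) ->
  data_independent_split P Y D0 ->
  (forall w, measurable_fun [set: N.-tuple X] (T (D0 w))) ->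
  (forall w y, 0 <= T (D0 w) y) ->
  (forall w, \int[distribution P (sample Y)]_y (T (D0 w) y)%:E <= 1)%E ->
  (P [set w | (1 / alpha < T (D0 w) (sample Y w))%R] <= alpha%:E)%E.
Proof.
move=> alpha0 mD0 indep mT T0 intT.
pose B D := [set y | (1 / alpha < T D y)%R].
have mB w : measurable (B (D0 w)).
  have -> : B (D0 w) = T (D0 w) @^-1` `]1 / alpha, +oo[.
    by apply/seteqP; split=> y; rewrite /B /= in_itv/= andbT.
  by rewrite -[X in measurable X]setTI; exact: mT.
have mS A : measurable A -> measurable (sample Y @^-1` A).
  by move=> mA; rewrite -[X in measurable X]setTI; exact: measurable_sample.
(* Markov's inequality at the threshold [1 / alpha], for the deterministic split [D0 w]. *)
have markov w : (P (sample Y @^-1` B (D0 w)) <= alpha%:E)%E.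
  have := @le_integral_comp_abse _ _ _ (distribution P (sample Y)) _ measurableT
    (EFin \o T (D0 w)) (1 / alpha) id (@measurable_id _ _ _) (fun r r0 => r0)
    (fun x y _ _ xy => xy).
  rewrite divr_gt0// => /(_ _ isT) H.
  have {}H := H ((measurable_EFinP _ _).2 (mT w)).
  have le1 : ((1 / alpha)%:E * P (sample Y @^-1` B (D0 w)) <= 1)%E.
    apply: le_trans (intT w).
    rewrite (eq_integral (fun y => `|(EFin \o T (D0 w)) y|%E)); last first.
      by move=> y _; rewrite /= ger0_norm.
    apply: le_trans H; apply: lee_wpmul2l.
      by rewrite lee_fin divr_ge0// ltW.
    apply: le_measure; rewrite ?inE.
    - exact: mS (mB w).
    - by apply: mS; apply: emeasurable_fun_c_infty => //; apply: measurableT_comp => //; exact/measurable_EFinP.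
    by move=> y /=; rewrite /B /= => yB; split => //; rewrite lee_fin ger0_norm// ltW.
  by rewrite -(mul1e alpha%:E) -lee_pdivrMr//; rewrite muleC -(div1r alpha).
(* [B D] is known to be measurable only when [D] is a value of [D0]; otherwise the event is
   empty. *)
have mE D : measurable ([set w | D0 w = D] `&` sample Y @^-1` B D).
  have [->|/set0P[w /= <-]] := eqVneq [set w | D0 w = D] set0.
    by rewrite set0I.
  by apply: measurableI; [exact: mD0|exact: mS (mB w)].
have split_set (A : {set 'I_N} -> set Omega) :
    [set w | A (D0 w) w] =
    \bigcup_(D in [set: {set 'I_N}]) ([set w | D0 w = D] `&` A D).
  apply/seteqP; split=> w /=; first by exists (D0 w).
  by move=> [D _ [/= ->]].
have trivD (A : {set 'I_N} -> set Omega) :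
    trivIset [set: {set 'I_N}] (fun D => [set w | D0 w = D] `&` A D).
  by move=> D D' _ _ [w [[/= <- _] [/= <- _]]].
rewrite (split_set (fun D => sample Y @^-1` B D)).
have fin : finite_set [set: {set 'I_N}] by exact: finite_finset.
rewrite measure_fin_bigcup//.
(* The probabilities of the values of [D0] are the weights of the mixture. *)
have tot : (\sum_(D \in [set: {set 'I_N}]) P [set w | D0 w = D] = 1)%E.
  transitivity (P [set: Omega]); last exact: probability_setT.
  rewrite (_ : [set: Omega] = [set w | (fun=> setT) (D0 w) w])//.
  rewrite (split_set (fun=> setT)) measure_fin_bigcup//.
    by apply: eq_fsbigr => D _; rewrite setIT.
  by move=> D _; rewrite setIT.
rewrite -(mule1 alpha%:E) -tot ge0_mule_fsumr//.
apply: lee_fsum => // D _.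
have [->|/set0P[w /= <-]] := eqVneq [set w | D0 w = D] set0.
  by rewrite set0I !measure0 mule0.
by rewrite indep//= muleC; apply: lee_wpmul2r.
Qed.

End sample_law.

(** * Expectation of the split likelihood ratio under a null parameter *)

Section split_LR.
Context {d : measure_display} {X : measurableType d} {R : realType}
  {Theta : Type} {N : nat}.
Variables (mu : {measure set X -> \bar R}) (P : Theta -> probability X R)
  (p : Theta -> X -> R).
Hypothesis p_density : forall theta, is_density mu (P theta) (p theta).

Lemma likelihood_ge0 (D : {set 'I_N}) theta y : 0 <= likelihood p D theta y.
Proof. by apply: prodr_ge0 => i _; case: (p_density theta). Qed.

Lemma split_LR_ge0 (est mle : {set 'I_N} -> N.-tuple X -> Theta) D y :
  0 <= split_LR p est mle D y.
Proof. by rewrite divr_ge0// likelihood_ge0. Qed.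

Lemma measurable_split_LR (est mle : {set 'I_N} -> N.-tuple X -> Theta) D :
  measurable_fun [set: N.-tuple X]
    (fun y => likelihood p D (est (~: D)%SET y) y) ->
  measurable_fun [set: N.-tuple X] (fun y => likelihood p D (mle D y) y) ->
  measurable_fun [set: N.-tuple X] (split_LR p est mle D).
Proof. by move=> mest mmle; apply: measurable_funM => //; exact: measurable_funV. Qed.

Variables (theta : Theta) (m : probability (N.-tuple X) R).
Hypothesis m_box : forall A, (forall i, measurable (A i)) ->
  m (box A) = (\prod_i P theta (A i))%E.

(** Each coordinate has law [P theta], which does not charge the zeros of its own density, and there
    are finitely many coordinates. *)
Lemma likelihood_ae_neq0 (D : {set 'I_N}) :
  {ae m, forall y, likelihood p D theta y != 0}.
Proof.
have [mp p0 _] := p_density theta.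
pose Z := [set x | p theta x = 0].
have mZ : measurable Z.
  by rewrite -[X in measurable X]setTI; exact: mp (measurable_set1 0).
have PZ := density_eq0_negligible _ _ _ (p_density theta).
have pne0 : {ae m, forall y, forall i, p theta (tnth y i) != 0}.
  apply: filter_forall => i.
  have mA j : measurable (if j == i then Z else setT) by case: ifP.
  exists (box (fun j => if j == i then Z else setT)); split.
  - exact: measurable_box.
  - rewrite m_box// (bigD1 i)//= eqxx.
    by rewrite (_ : P theta Z = 0%E)// mul0e.
  move=> y /= /negP; rewrite negbK => /eqP py j.
  by case: eqP => // ->.
apply: filterS pne0 => y yne0.
by rewrite prodf_seq_neq0; apply/allP => i _; rewrite yne0 implybT.
Qed.

(** The null maximum dominates the likelihood at [theta], so the ratio is almost surely at most a
    product over [D] of density ratios at the parameter [est (~: D) y]. Resampling coordinates in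
    [D] does not move this parameter, so [integral_le1_of_le_prod] applies. *)
Lemma integral_split_LR_le1 (Theta0 : set Theta)
    (est mle : {set 'I_N} -> N.-tuple X -> Theta) (D : {set 'I_N}) :
  Theta0 theta ->
  constructed_from (~: D)%SET (est (~: D)%SET) ->
  (forall y, is_argmax Theta0 (fun t => likelihood p D t y) (mle D y)) ->
  measurable_fun [set: N.-tuple X]
    (fun y => likelihood p D (est (~: D)%SET y) y) ->
  measurable_fun [set: N.-tuple X] (fun y => likelihood p D (mle D y) y) ->
  (\int[m]_y (split_LR p est mle D y)%:E <= 1)%E.
Proof.
move=> theta_null est_from mleP mest mmle.
have mU := measurable_split_LR est mle D mest mmle.
have mp t : measurable_fun [set: X] (p t) by case: (p_density t).
have p0 t x : 0 <= p t x by case: (p_density t).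
pose L y := likelihood p D theta y.
have mL : measurable_fun [set: N.-tuple X] L.
  rewrite /L /likelihood; under eq_fun do rewrite -big_enum.
  apply: measurable_prod => i _.
  exact: (measurableT_comp (mp theta) (measurable_tnth i)).
(* [L y / L y] is the indicator of [L y != 0], since [0 / 0 = 0]. *)
pose V y := split_LR p est mle D y * (L y / L y).
have mV : measurable_fun [set: N.-tuple X] V.
  by apply: measurable_funM => //; apply: measurable_funM => //; exact: measurable_funV.
have V0 y : 0 <= V y.
  by rewrite mulr_ge0 ?split_LR_ge0// divr_ge0// likelihood_ge0.
have VE : ae_eq m setT (fun y => (split_LR p est mle D y)%:E) (EFin \o V).
  apply: filterS (likelihood_ae_neq0 D) => y Ly0 _.
  by rewrite /= /V divff// mulr1.
(* The product bound must hold at every [y]. Where [L y] is 0 the product of ratios is 0 while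
   [split_LR] may be positive, hence the passage to [V], which vanishes there. *)
rewrite (ge0_ae_eq_integral _ _ _ _ _ VE)//; last 4 first.
- exact/measurable_EFinP.
- exact/measurable_EFinP.
- by move=> y _; rewrite lee_fin split_LR_ge0.
- by move=> y _; rewrite lee_fin.
apply: (integral_le1_of_le_prod (P theta) m (fun t x => p t x / p theta x) m_box
  _ _ _ (enum D) (est (~: D)%SET)).
- by move=> t; apply: measurable_funM => //; exact: measurable_funV.
- by move=> t x; rewrite divr_ge0.
- by move=> t; exact: integral_density_ratio (p_density theta) (p_density t).
- exact: enum_uniq.
- move=> i z; rewrite mem_enum => iD; apply: est_from => j.
  rewrite finset.in_setC tnth_tset; case: eqP => // -> /negP.
  by rewrite iD.
- exact/measurable_EFinP.
- by move=> y; rewrite lee_fin.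
move=> y; rewrite lee_fin big_enum /= big_split/= prodfV.
rewrite -/(likelihood p D (est (~: D)%SET y) y) -/(likelihood p D theta y) -/(L y).
rewrite /V; have [->|Ly0] := eqVneq (L y) 0; first by rewrite invr0 !mulr0.
rewrite divff// mulr1; apply: ler_wpM2l; first exact: likelihood_ge0.
have Lpos : 0 < L y by rewrite lt_def Ly0 likelihood_ge0.
have Lmle : L y <= likelihood p D (mle D y) y by apply: (mleP y).2.
by rewrite lef_pV2// posrE//; exact: lt_le_trans Lmle.
Qed.

End split_LR.

(** * Type I error of the split and crossfit tests *)

Theorem theorem3 (R : realType) (alpha : R) (alpha_gt0 : 0 < alpha)
  (alpha_lt1 : alpha < 1)
  (dX : measure_display) (X : measurableType dX)
  (mu : {measure set X -> \bar R})
  (Theta : Type) (P : Theta -> probability X R) (p : Theta -> X -> R)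
  (p_density : forall theta, is_density mu (P theta) (p theta))
  (Theta0 : set Theta)
  (* the sample; Pr theta is the probability when theta is the true parameter *)
  (n : nat) (dO : measure_display) (Omega : measurableType dO)
  (Pr : Theta -> probability Omega R)
  (Y : 'I_(2 * n) -> {mfun Omega >-> X})
  (Y_iid : forall theta, iid (Pr theta) (P theta) Y)
  (* the split: D0 and its complement *)
  (D0 : Omega -> {set 'I_(2 * n)})
  (D0_size : forall w, #|D0 w| = n)
  (D0_measurable : forall D, measurable [set w | D0 w = D])
  (D0_indep : forall theta, data_independent_split (Pr theta) Y D0)
  (* for each half D, the estimators constructed from D *)
  (est est_swap mle : {set 'I_(2 * n)} -> (2 * n).-tuple X -> Theta)
  (est_from : forall D : {set 'I_(2 * n)}, #|D| = n -> constructed_from D (est D))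
  (est_swap_from : forall D : {set 'I_(2 * n)}, #|D| = n -> constructed_from D (est_swap D))
  (mle_from : forall D : {set 'I_(2 * n)}, #|D| = n -> constructed_from D (mle D))
  (mle_argmax : forall (D : {set 'I_(2 * n)}) y, #|D| = n ->
     is_argmax Theta0 (fun theta => likelihood p D theta y) (mle D y))
  (est_measurable : forall D : {set 'I_(2 * n)}, #|D| = n ->
     measurable_fun [set: (2 * n).-tuple X]
       (fun y => likelihood p D (est (~: D) y) y))
  (est_swap_measurable : forall D : {set 'I_(2 * n)}, #|D| = n ->
     measurable_fun [set: (2 * n).-tuple X]
       (fun y => likelihood p D (est_swap (~: D) y) y))
  (mle_measurable : forall D : {set 'I_(2 * n)}, #|D| = n ->
     measurable_fun [set: (2 * n).-tuple X]
       (fun y => likelihood p D (mle D y) y)) :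
  let U := fun w => split_LR p est mle (D0 w) (sample Y w) in
  let W := fun w => crossfit_LR p est est_swap mle (D0 w) (sample Y w) in
  (ereal_sup [set Pr theta [set w | (1 / alpha < U w)%R] | theta in Theta0]
     <= alpha%:E)%E
  /\
  (ereal_sup [set Pr theta [set w | (1 / alpha < W w)%R] | theta in Theta0]
     <= alpha%:E)%E.
Proof.
move=> U W.
have cardC (D : {set 'I_(2 * n)}) : #|D| = n -> #|~: D| = n.
  move=> Dn; apply: (@addnI n); transitivity (2 * n)%N.
    by rewrite -[X in (X + _)%N]Dn cardsC card_ord.
  by rewrite mul2n addnn.
have mLR (est' : {set 'I_(2 * n)} -> (2 * n).-tuple X -> Theta) : (forall D : {set 'I_(2 * n)}, #|D| = n ->
      measurable_fun [set: (2 * n).-tuple X]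
        (fun y => likelihood p D (est' (~: D)%SET y) y)) ->
    forall D : {set 'I_(2 * n)}, #|D| = n ->
    measurable_fun [set: (2 * n).-tuple X] (split_LR p est' mle D).
  by move=> mest' D Dn; apply: measurable_split_LR; [exact: mest'|exact: mle_measurable].
(* Stated for any estimator and any half, so that it serves both [est] on [D0 w] and [est_swap] on
   its complement. *)
have intLR (est' : {set 'I_(2 * n)} -> (2 * n).-tuple X -> Theta) theta : Theta0 theta ->
    (forall D : {set 'I_(2 * n)}, #|D| = n -> constructed_from D (est' D)) ->
    (forall D : {set 'I_(2 * n)}, #|D| = n ->
      measurable_fun [set: (2 * n).-tuple X]
        (fun y => likelihood p D (est' (~: D)%SET y) y)) ->
    forall D : {set 'I_(2 * n)}, #|D| = n ->
    (\int[distribution (Pr theta) (sample Y)]_y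
       (split_LR p est' mle D y)%:E <= 1)%E.
  move=> theta_null est'_from mest' D Dn.
  apply: (integral_split_LR_le1 mu P p p_density theta _ _ Theta0) => //.
  - exact: distribution_sample_box.
  - exact/est'_from/cardC.
  - by move=> y; exact: mle_argmax.
  - exact: mest'.
  - exact: mle_measurable.
split; apply: ge_ereal_sup => _ [theta theta_null <-].
- apply: (split_test_level Y (Pr theta) D0 alpha (split_LR p est mle)) => // w.
  + exact: mLR.
  + by move=> y; exact: split_LR_ge0.
  + exact: intLR.
apply: (split_test_level Y (Pr theta) D0 alpha (crossfit_LR p est est_swap mle)) => // w.
- apply: measurable_funM => //; apply: measurable_funD; apply: mLR => //.
  exact: cardC.
- by move=> y; rewrite divr_ge0// addr_ge0// (split_LR_ge0 mu P).
have mU : measurable_fun [set: (2 * n).-tuple X]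
    (fun y => (split_LR p est mle (D0 w) y)%:E).
  by apply/measurable_EFinP; exact: mLR.
have mUswap : measurable_fun [set: (2 * n).-tuple X]
    (fun y => (split_LR p est_swap mle (~: D0 w)%SET y)%:E).
  by apply/measurable_EFinP; apply: mLR => //; exact: cardC.
have U0 est' D y : (0 <= (split_LR p est' mle D y)%:E)%E.
  by rewrite lee_fin (split_LR_ge0 mu P).
(* By linearity the mean of the two ratios has expectation at most 1, whatever their dependence. *)
under eq_integral do rewrite /crossfit_LR EFinM EFinD muleC.
rewrite ge0_integralZl//; last 2 first.
- exact: emeasurable_funD.
- by move=> y _; exact: adde_ge0.
rewrite ge0_integralD//.
apply: (@le_trans _ _ (2^-1%:E * (1 + 1))%E).
  apply: lee_wpmul2l; first by rewrite lee_fin.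
  by apply: leeD; apply: intLR => //; exact: cardC.
by rewrite -EFinD -EFinM lee_fin mulVf.
Qed.
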